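(* Let $\mathcal{A}$ be a unital local operator algebra. Then for any $a=(a_1,\dots,a_d)\in\mathcal{A}^{1\times d}$ there is a well-defined unital homomorphism $\varphi_a:\mathcal{O}_d\to\mathcal{A}$, $\varphi_a(h)=h(a)$, obeying $\varphi_a(z_i)=a_i$ for $1\le i\le d$. If $\mathcal{A}$ is also stably finite, then any $f\in\mathcal{M}_d$ has a well-defined $\mathcal{A}$-domain and evaluations, $$\mathrm{Dom}_{\mathcal{A}}(f):=\{a\in\mathcal{A}^{1\times d} : \text{there is } f\sim(A,b,c;\vec h)\text{ such that }A(\vec h(a))^{-1}\text{ exists}\},$$ $$f(a)=(1_{\mathcal{A}}\otimes b^* )\,A(\vec h(a))^{-1}\,(1_{\mathcal{A}}\otimes c),\qquad a\in\mathrm{Dom}_{\mathcal{A}}(f),$$ i.e. the value $f(a)$ is independent of the choice of formal representation $f\sim(A,b,c;\vec h)$ for which $A(\vec h(a))$ is invertible.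
   Context: **Local operator algebras.** A matrix semi-norm on a unital complex algebra $\mathcal{A}$ is a family of semi-norms $\rho=(\rho_n:\mathcal{A}^{n\times n}\to[0,\infty))_{n\ge1}$ with (1) $\rho_{m+n}(a\oplus b)=\max\{\rho_m(a),\rho_n(b)\}$ for $a\in\mathcal{A}^{m\times m}$, $b\in\mathcal{A}^{n\times n}$, and (2) $\rho_m(\alpha a\beta)\le\|\alpha\|\rho_n(a)\|\beta\|$ for $\alpha\in\mathbb{C}^{m\times n}$, $\beta\in\mathbb{C}^{n\times m}$, $a\in\mathcal{A}^{n\times n}$. It is an algebra matrix semi-norm (matrix-multiplicative) if moreover (3) $\rho_n(AB)\le\rho_n(A)\rho_n(B)$ for $A,B\in\mathcal{A}^{n\times n}$, and unital if $\rho_1(1)=1$. A unital local operator algebra is a unital and separable topological algebra over $\mathbb{C}$ equipped with a family of unital matrix-multiplicative matrix semi-norms that generate its topology. **Entire NC functions.** $\mathcal{O}_d$ is the ring of formal power series $h=\sum_{\omega}\hat h_\omega z^\omega$ over words $\omega$ in $\{1,\dots,d\}$, in non-commuting variables $z=(z_1,\dots,z_d)$, with complex coefficients satisfying $\lim_{\ell\to\infty}\big(\sum_{|\omega|=\ell}|\hat h_\omega|^2\big)^{1/(2\ell)}=0$. For $a\in\mathcal{A}^{1\times d}$, $h(a)$ denotes the limit in $\mathcal{A}$ of the partial sums $\sum_{\ell=0}^N\sum_{|\omega|=\ell}\hat h_\omega a^\omega$ as $N\to\infty$; that these partial sums converge to an element of $\mathcal{A}$ is part of the assertion that $\varphi_a$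 is well-defined. **The skew field $\mathcal{M}_d$.** $\mathcal{O}_d$ is a semifir (every finitely generated right ideal is free as a right module), so by Cohn it has a universal skew field of fractions $\mathcal{M}_d$: a skew field containing, and generated by, $\mathcal{O}_d$, over which every full square matrix over $\mathcal{O}_d$ becomes invertible ($M\in\mathcal{O}_d^{n\times n}$ is full if it is not a product $BC$ with $B\in\mathcal{O}_d^{n\times m}$, $C\in\mathcal{O}_d^{m\times n}$, $m<n$). A formal representation $f\sim(A,b,c;\vec h)$ of $f\in\mathcal{M}_d$ consists of $n,k\in\mathbb{N}$, $A=(A_0,\dots,A_k)$ with $A_j\in\mathbb{C}^{n\times n}$, $b,c\in\mathbb{C}^n$ and $\vec h=(h_1,\dots,h_k)\in\mathcal{O}_d^{1\times k}$ such that $A(\vec h):=A_0+\sum_jh_jA_j$ is invertible over $\mathcal{M}_d$ and $f=b^*A(\vec h)^{-1}c$. Every $f\in\mathcal{M}_d$ has such a representation. Put $A(\vec h(a)):=1_{\mathcal{A}}\otimes A_0+\sum_jh_j(a)\otimes A_j\in\mathcal{A}^{n\times n}$, where $h_j(a)=\varphi_a(h_j)$; inverses are taken in $\mathcal{A}^{n\times n}$. A unital algebra $\mathcal{A}$ is stably finite if for all $n$ and $X,Y\in\mathcal{A}^{n\times n}$, $XY=I$ implies $YX=I$.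
   Formalization: The algebra is additionally assumed sequentially complete (otherwise, e.g. for polynomials with disk sup-norms, exp(x) has no limit in the algebra), and ''separable'' is read as separated (Hausdorff), so that the limits h(a) exist and are unique. *)

(* Defs.v *)
From HB Require Import structures.
From mathcomp Require Import all_boot all_order all_algebra.
From mathcomp Require Import complex.
From mathcomp Require Import all_classical all_reals all_analysis.

Set Implicit Arguments.
Unset Strict Implicit.
Unset Printing Implicit Defensive.

Import Order.TTheory GRing.Theory Num.Theory.
Import numFieldNormedType.Exports.
Import Normc.

Local Open Scope classical_set_scope.
Local Open Scope ring_scope.

HB.mixin Record isTopologicalAlgebra (K : numDomainType) A
    & GRing.Algebra K A & Topological A := {
  mul_continuous : continuous (fun x : A * A => x.1 * x.2)
}.

#[short(type="topologicalAlgType")]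
HB.structure Definition TopologicalAlgebra (K : numDomainType) :=
  {A of GRing.Algebra K A & TopologicalLmodule K A & isTopologicalAlgebra K A}.

Section MatrixNorms.
Variable R : realType.

Definition l2norm n (v : 'cV[R[i]]_n) : R :=
  Num.sqrt (\sum_(i < n) normc (v i 0) ^+ 2).

Definition opnorm m n (alpha : 'M[R[i]]_(m, n)) : R :=
  sup [set l2norm (alpha *m v) | v in [set v | l2norm v <= 1]].

(* A complex matrix seen as a matrix over a complex algebra. *)
Definition scalar_entries (B : algType R[i]) m n (X : 'M[R[i]]_(m, n)) :
  'M[B]_(m, n) := map_mx (in_alg B) X.

Variable A : algType R[i].

(* The value of [rho] on matrices of size 0 is irrelevant. *)
Record matrix_seminorm (rho : forall n, 'M[A]_n -> R) : Prop := {
  mxseminorm_ge0 : forall n (a : 'M[A]_n), (0 < n)%N -> 0 <= rho n a;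
  mxseminormD : forall n (a b : 'M[A]_n), (0 < n)%N ->
    rho n (a + b) <= rho n a + rho n b;
  mxseminormZ : forall n (z : R[i]) (a : 'M[A]_n), (0 < n)%N ->
    rho n (map_mx ( *:%R z) a) = normc z * rho n a;
  mxseminorm_dsum : forall m n (a : 'M[A]_m) (b : 'M[A]_n),
    (0 < m)%N -> (0 < n)%N ->
    rho (m + n)%N (block_mx a 0 0 b) = Num.max (rho m a) (rho n b);
  mxseminorm_bimod : forall m n (alpha : 'M[R[i]]_(m, n)) (a : 'M[A]_n)
      (beta : 'M[R[i]]_(n, m)), (0 < m)%N -> (0 < n)%N ->
    rho m (scalar_entries A alpha *m a *m scalar_entries A beta)
      <= opnorm alpha * rho n a * opnorm beta
}.

Record unital_algebra_matrix_seminorm (rho : forall n, 'M[A]_n -> R) : Prop := {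
  algmxseminorm_mx :> matrix_seminorm rho;
  algmxseminormM : forall n (a b : 'M[A]_n), (0 < n)%N ->
    rho n (a *m b) <= rho n a * rho n b;
  algmxseminorm1 : rho 1%N 1%:M = 1
}.

Definition stably_finite : Prop :=
  forall n (X Y : 'M[A]_n), X *m Y = 1%:M -> Y *m X = 1%:M.

End MatrixNorms.

(* "Separable" is taken in the sense of "separated", i.e. Hausdorff, which is
   what makes limits in A unique; no countable dense subset is required. *)
Record unital_local_operator_algebra (R : realType)
    (A : topologicalAlgType R[i]) (I : Type)
    (rho : I -> forall n, 'M[A]_n -> R) : Prop := {
  loa_separated : hausdorff_space A;
  loa_seminorm : forall i, unital_algebra_matrix_seminorm (rho i);
  (* The semi-norms on larger matrices are dominated by those of the entries,
     so the topology on A is the one generated by the [rho i 1]. *)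
  loa_topology : forall (x : A) (U : set A), nbhs x U <->
    exists2 J : set I, finite_set J & exists2 e : R, 0 < e &
      [set y | forall i, J i -> rho i 1%N (y - x)%:M < e] `<=` U
}.

(* Not automatic for an algebra whose topology is generated by semi-norms (take
   polynomials in one variable with the sup norm on a disk); without it the
   series of exp, say, need not converge in A. *)
Definition sequentially_complete (R : realType)
    (A : topologicalAlgType R[i]) : Prop :=
  forall u : nat -> A,
    (fun p : nat * nat => u p.1 - u p.2) @ filter_prod \oo \oo --> (0 : A) ->
    exists l : A, u @ \oo --> l.

Section NCSeries.
Variables (R : realType) (d : nat).

Record ncseries := NCSeries { nccoef :> seq 'I_d -> R[i] }.

Lemma ncseriesP (f g : ncseries) : f =1 g -> f = g.
Proof. by case: f g => [f] [g] /= fg; congr NCSeries; apply/funext. Qed.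

HB.instance Definition _ := gen_eqMixin ncseries.
HB.instance Definition _ := gen_choiceMixin ncseries.

Definition ncs_zero := NCSeries (fun=> 0).
Definition ncs_opp (f : ncseries) := NCSeries (fun w => - f w).
Definition ncs_add (f g : ncseries) := NCSeries (fun w => f w + g w).
Definition ncs_scale (z : R[i]) (f : ncseries) := NCSeries (fun w => z * f w).
Definition ncs_one := NCSeries (fun w => (w == [::])%:R).

Definition ncs_mul (f g : ncseries) := NCSeries (fun w =>
  \sum_(i < (size w).+1) f (take i w) * g (drop i w)).

Fact ncs_addA : associative ncs_add.
Proof. by move=> f g h; apply: ncseriesP => w /=; rewrite addrA. Qed.
Fact ncs_addC : commutative ncs_add.
Proof. by move=> f g; apply: ncseriesP => w /=; rewrite addrC. Qed.
Fact ncs_add0 : left_id ncs_zero ncs_add.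
Proof. by move=> f; apply: ncseriesP => w /=; rewrite add0r. Qed.
Fact ncs_addN : left_inverse ncs_zero ncs_opp ncs_add.
Proof. by move=> f; apply: ncseriesP => w /=; rewrite addNr. Qed.

HB.instance Definition _ :=
  GRing.isZmodule.Build ncseries ncs_addA ncs_addC ncs_add0 ncs_addN.

Let tail x (f : ncseries) := NCSeries (fun w => f (x :: w)).

Lemma ncs_mul_nil f g : ncs_mul f g [::] = f [::] * g [::].
Proof. by rewrite /= big_ord1. Qed.

Lemma ncs_mul_cons f g x w :
  ncs_mul f g (x :: w) = f [::] * g (x :: w) + ncs_mul (tail x f) g w.
Proof. by rewrite /= big_ord_recl. Qed.

Fact ncs_mulDl : left_distributive ncs_mul ncs_add.
Proof.
move=> f g h; apply: ncseriesP => w /=; rewrite -big_split.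
by apply: eq_bigr => i _; rewrite mulrDl.
Qed.

Fact ncs_mulDr : right_distributive ncs_mul ncs_add.
Proof.
move=> f g h; apply: ncseriesP => w /=; rewrite -big_split.
by apply: eq_bigr => i _; rewrite mulrDr.
Qed.

Fact ncs_scaleAl z f g : ncs_scale z (ncs_mul f g) = ncs_mul (ncs_scale z f) g.
Proof.
apply: ncseriesP => w /=; rewrite mulr_sumr.
by apply: eq_bigr => i _; rewrite mulrA.
Qed.

Fact ncs_scaleAr z f g : ncs_scale z (ncs_mul f g) = ncs_mul f (ncs_scale z g).
Proof.
apply: ncseriesP => w /=; rewrite mulr_sumr.
by apply: eq_bigr => i _; rewrite mulrCA.
Qed.

Fact ncs_mulA : associative ncs_mul.
Proof.
move=> f g h; apply: ncseriesP => w; elim: w f g h => [|x w IH] f g h.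
  by rewrite !ncs_mul_nil mulrA.
rewrite !ncs_mul_cons ncs_mul_nil mulrDr -addrA mulrA; congr (_ + _).
have -> : tail x (ncs_mul f g)
    = ncs_add (ncs_scale (f [::]) (tail x g)) (ncs_mul (tail x f) g).
  by apply: ncseriesP => v; exact: ncs_mul_cons.
rewrite ncs_mulDl -ncs_scaleAl [RHS]/=; congr (_ + _); exact: IH.
Qed.

Fact ncs_mul1l : left_id ncs_one ncs_mul.
Proof.
move=> f; apply: ncseriesP => -[|x w]; first by rewrite ncs_mul_nil mul1r.
rewrite ncs_mul_cons mul1r /= big1 ?addr0// => i _.
by rewrite mul0r.
Qed.

Fact ncs_mul1r : right_id ncs_one ncs_mul.
Proof.
move=> f; apply: ncseriesP => w; elim: w f => [|x w IH] f.
  by rewrite ncs_mul_nil mulr1.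
by rewrite ncs_mul_cons IH /= mulr0 add0r.
Qed.

Fact ncs_oner_neq0 : ncs_one != 0.
Proof.
apply/eqP => /(congr1 (fun f : ncseries => f [::])) /= /eqP.
by rewrite oner_eq0.
Qed.

HB.instance Definition _ := GRing.Zmodule_isNzRing.Build ncseries
  ncs_mulA ncs_mul1l ncs_mul1r ncs_mulDl ncs_mulDr ncs_oner_neq0.

Fact ncs_scaleA z t f : ncs_scale z (ncs_scale t f) = ncs_scale (z * t) f.
Proof. by apply: ncseriesP => w /=; rewrite mulrA. Qed.
Fact ncs_scale1 : left_id 1 ncs_scale.
Proof. by move=> f; apply: ncseriesP => w /=; rewrite mul1r. Qed.
Fact ncs_scaleDr : right_distributive ncs_scale +%R.
Proof. by move=> z f g; apply: ncseriesP => w /=; rewrite mulrDr. Qed.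
Fact ncs_scaleDl f : {morph ncs_scale^~ f : z t / z + t}.
Proof. by move=> z t; apply: ncseriesP => w /=; rewrite mulrDl. Qed.

HB.instance Definition _ := GRing.Zmodule_isLmodule.Build R[i] ncseries
  ncs_scaleA ncs_scale1 ncs_scaleDr ncs_scaleDl.
HB.instance Definition _ :=
  GRing.Lmodule_isLalgebra.Build R[i] ncseries ncs_scaleAl.
HB.instance Definition _ :=
  GRing.Lalgebra_isAlgebra.Build R[i] ncseries ncs_scaleAr.

(* At l = 0 the exponent is / 0 = 0; this term does not affect the limit. *)
Definition entire_series (h : ncseries) : Prop :=
  ((\sum_(w : l.-tuple 'I_d) normc (h w) ^+ 2) `^ ((2 * l)%:R^-1) : R)
    @[l --> \oo] --> (0 : R).


Lemma entire_coef_bound h : entire_series h ->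
  forall e : R, 0 < e -> exists2 K : R, 0 <= K &
    forall w, normc (h w) <= K * e ^+ size w.
Proof.
move=> hh e e0.
move: (hh) => /cvgr0_norm_lt/(_ _ e0) [N _ HN].
pose S l := \sum_(w : l.-tuple 'I_d) normc (h w) ^+ 2.
have S0 l : 0 <= S l by apply: sumr_ge0 => w _; exact: sqr_ge0.
have wS w : normc (h w) ^+ 2 <= S (size w).
  rewrite /S (bigD1 (in_tuple w))//= lerDl.
  by apply: sumr_ge0 => v _; exact: sqr_ge0.
have e'0 l : 0 < e ^+ l by exact: exprn_gt0.
exists (1 + \sum_(l < N.+1) S l / (e ^+ l) ^+ 2).
  by rewrite addr_ge0// sumr_ge0// => l _; rewrite divr_ge0// exprn_ge0// ltW.
move=> w; set l := size w.
rewrite -(@ler_pXn2r _ 2)//; last 2 first.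
- by rewrite nnegrE; case: (h w) => a b; exact: sqrtr_ge0.
- rewrite nnegrE mulr_ge0 ?(ltW (e'0 _))// addr_ge0// sumr_ge0// => k _.
  by rewrite divr_ge0// exprn_ge0// ltW.
apply: le_trans (wS w) _; rewrite -/l exprMn -ler_pdivrMr ?exprn_gt0//.
set T := \sum_(_ < _) _.
have T0 : 0 <= T.
  by apply: sumr_ge0 => k _; rewrite divr_ge0// exprn_ge0// ltW.
suff : S l / (e ^+ l) ^+ 2 <= 1 + T.
  move=> /le_trans; apply; rewrite expr2 ler_peMr ?addr_ge0//.
  by rewrite lerDl.
have [lN|Nl] := leqP l N.
  have lN' : (l < N.+1)%N by [].
  rewrite /T (bigD1 (Ordinal lN'))//= addrCA lerDl.
  apply: addr_ge0 => //.
  by apply: sumr_ge0 => k _; rewrite divr_ge0// exprn_ge0// ltW.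
apply: (@le_trans _ _ 1); last by rewrite lerDl.
rewrite ler_pdivrMr ?exprn_gt0// mul1r.
have l0 : (0 < l)%N by exact: leq_ltn_trans Nl.
have := HN l (ltnW Nl); rewrite /= -/(S l) ger0_norm ?powR_ge0// => /ltW Hl.
have -> : S l = (S l `^ (2 * l)%:R^-1) ^+ (2 * l).
  rewrite -powR_mulrn ?powR_ge0// -powRrM mulVf ?powRr1//.
  by rewrite pnatr_eq0 muln_eq0/= -lt0n.
rewrite -exprM [(l * 2)%N]mulnC; apply: lerXn2r => //; rewrite ?nnegrE ?powR_ge0 ?(ltW e0)//.
Qed.

Lemma entire_of_coef_bound (h : ncseries) :
  (forall e : R, 0 < e -> exists2 K : R, 0 <= K &
    forall w, normc (h w) <= K * e ^+ size w) -> entire_series h.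
Proof.
move=> H; apply/cvgr0Pnorm_le => e e0.
have c0 : 0 < 2 * d.+1%:R :> R by rewrite mulr_gt0.
have [K K0 hK] := H (e / (2 * d.+1%:R)) (divr_gt0 e0 c0).
have [N KN] : exists N : nat, K ^+ 2 <= N%:R.
  by exists (Num.bound (K ^+ 2)); apply: ltW; apply: archi_boundP; rewrite sqr_ge0.
exists N.+1 => // l /= Nl; rewrite ger0_norm ?powR_ge0//.
have l0 : (0 < l)%N by exact: leq_ltn_trans Nl.
set S := \sum_(_ | _) _.
have S0 : 0 <= S by apply: sumr_ge0 => w _; exact: sqr_ge0.
suff Se : S <= e ^+ (2 * l).
  have -> : e = (e ^+ (2 * l)) `^ (2 * l)%:R^-1.
    rewrite -powR_mulrn ?ltW// -powRrM divff ?powRr1 ?ltW//.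
    by rewrite pnatr_eq0 muln_eq0/= -lt0n.
  by apply: ge0_ler_powR; rewrite ?nnegrE ?exprn_ge0 ?(ltW e0) ?invr_ge0.
set q := e / (2 * d.+1%:R) in hK *.
have q0 : 0 < q by exact: divr_gt0.
have eE : e = q * (2 * d.+1%:R) by rewrite divfK// gt_eqF.
clearbody q.
apply: (@le_trans _ _ (\sum_(w : l.-tuple 'I_d) (K * q ^+ l) ^+ 2)).
  apply: ler_sum => w _; apply: lerXn2r; rewrite ?nnegrE.
  - by case: (h w) => a b; exact: sqrtr_ge0.
  - by rewrite mulr_ge0// exprn_ge0// ltW.
  - by have := hK w; rewrite size_tuple.
rewrite sumr_const card_tuple card_ord -mulr_natr natrX.
rewrite eE exprMn -exprM [(l * 2)%N]mulnC mulrAC mulrC [X in _ <= X]exprMn.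
apply: ler_wpM2l; first by rewrite exprn_ge0// ltW.
have -> : (2 * d.+1%:R) ^+ (2 * l) = ((4 ^ l)%:R * ((d.+1 ^ 2) ^ l)%:R : R).
  by rewrite exprMn !exprM -!natrX.
apply: ler_pM; rewrite ?sqr_ge0 ?exprn_ge0//.
  apply: (le_trans KN); rewrite ler_nat.
  apply: leq_trans (ltnW Nl) _; apply: leq_trans (ltnW (ltn_expl l (ltnSn 1))) _.
  by rewrite leq_exp2r.
rewrite -natrX ler_nat leq_exp2r// (leq_trans (leqnSn d))//.
by rewrite leq_pmulr.
Qed.

Lemma entire_seriesE (h : ncseries) : entire_series h <->
  forall e : R, 0 < e -> exists2 K : R, 0 <= K &
    forall w, normc (h w) <= K * e ^+ size w.
Proof.
by split; [exact: entire_coef_bound|exact: entire_of_coef_bound].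
Qed.
Definition entire_pred : {pred ncseries} := fun h => `[< entire_series h >].

Fact entire_pred_closed : GRing.subalg_closed entire_pred.
Proof.
have finsupp w0 z : entire_series (NCSeries (fun w => (w == w0)%:R * z)).
  apply/entire_seriesE => e e0; exists (normc z / e ^+ size w0).
    by rewrite divr_ge0 ?exprn_ge0 ?(ltW e0)//; case: z => a b; exact: sqrtr_ge0.
  move=> w /=; case: eqP => [->|_].
    by rewrite mul1r divfK// gt_eqF// exprn_gt0.
  rewrite mul0r normc0 mulr_ge0 ?divr_ge0 ?exprn_ge0 ?(ltW e0)//.
  by case: z => a b; exact: sqrtr_ge0.
split.
- apply/asboolP; have := finsupp [::] 1; congr entire_series.
  by apply: ncseriesP => w /=; rewrite mulr1.
- move=> z f g /asboolP/entire_seriesE hf /asboolP/entire_seriesE hg.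
  apply/asboolP/entire_seriesE => e e0.
  have [K K0 hK] := hf e e0; have [L L0 hL] := hg e e0.
  have z0 : 0 <= normc z by case: (z) => a b; exact: sqrtr_ge0.
  exists (normc z * K + L); first by rewrite addr_ge0 ?mulr_ge0.
  move=> w; apply: (le_trans (le_normcD (z * f w) (g w))).
  by rewrite mulrDl normcM -mulrA; apply: lerD; [exact: ler_wpM2l|].
- move=> f g /asboolP/entire_seriesE hf /asboolP/entire_seriesE hg.
  apply/asboolP/entire_seriesE => e e0.
  have e20 : 0 < e / 2 by rewrite divr_gt0.
  have [K K0 hK] := hf _ e20; have [L L0 hL] := hg _ e20.
  exists (K * L); first by rewrite mulr_ge0.
  move=> w.
  have normc_sum n (F : 'I_n -> R[i]) :
      normc (\sum_i F i) <= \sum_i normc (F i).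
    elim/big_ind2 : _ => [|x a y b xa yb|//]; first by rewrite normc0.
    by apply: (le_trans (le_normcD _ _)); rewrite lerD.
  apply: (le_trans (normc_sum _ _)).
  apply: (@le_trans _ _ (\sum_(i < (size w).+1) K * L * (e / 2) ^+ size w)).
    apply: ler_sum => i _; rewrite normcM.
    have iw : (i <= size w)%N by rewrite -ltnS.
    rewrite -[in X in _ <= X](subnKC iw) exprD mulrACA.
    apply: ler_pM.
    + by case: (f _) => a b; exact: sqrtr_ge0.
    + by case: (g _) => a b; exact: sqrtr_ge0.
    + by have := hK (take i w); rewrite size_takel.
    + by have := hL (drop i w); rewrite size_drop.
  rewrite sumr_const card_ord -[leLHS]mulr_natr -[leLHS]mulrA.
  apply: ler_wpM2l; first by rewrite mulr_ge0.
  rewrite exprMn -mulrA ler_piMr ?exprn_ge0 ?(ltW e0)//.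
  rewrite exprVn mulrC ler_pdivrMr ?exprn_gt0// mul1r -natrX ler_nat.
  exact: ltn_expl.
Qed.

HB.instance Definition _ :=
  GRing.isSubalgClosed.Build R[i] ncseries entire_pred entire_pred_closed.

Record ncentire := NCEntire {
  ncentire_series :> ncseries;
  ncentire_seriesP : ncentire_series \in entire_pred
}.

HB.instance Definition _ := [isSub for ncentire_series].
HB.instance Definition _ := [Choice of ncentire by <:].
HB.instance Definition _ := [SubChoice_isSubAlgebra of ncentire by <:].

Definition ncvar_series (i : 'I_d) := NCSeries (fun w => (w == [:: i])%:R).

Fact ncvar_subproof i : ncvar_series i \in entire_pred.
Proof.
apply/asboolP/entire_seriesE => e e0; exists e^-1; first by rewrite invr_ge0 ltW.
move=> w /=; case: eqP => [->|_]; first by rewrite normc1 expr1 mulVf// gt_eqF.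
by rewrite normc0 mulr_ge0 ?invr_ge0 ?exprn_ge0 ?(ltW e0).
Qed.

Definition ncvar (i : 'I_d) : ncentire := NCEntire (ncvar_subproof i).

End NCSeries.

Section Evaluation.
Variables (R : realType) (d : nat) (A : topologicalAlgType R[i]).

Definition ncpartial_sum (h : ncentire R d) (a : 'rV[A]_d) (N : nat) : A :=
  \sum_(l < N.+1) \sum_(w : l.-tuple 'I_d) h w *: \prod_(i <- w) a 0 i.

(* The limit of the partial sums; the value is 0 if they do not converge. *)
Definition nceval (a : 'rV[A]_d) (h : ncentire R d) : A :=
  xget 0 [set x | ncpartial_sum h a @ \oo --> x].

End Evaluation.

Definition inverse_mx (B : pzRingType) n (X Y : 'M[B]_n) : Prop :=
  X *m Y = 1%:M /\ Y *m X = 1%:M.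

(* m = 0 is allowed: the zero matrix of size n > 0 is not full. *)
Definition full_mx (B : pzRingType) n (X : 'M[B]_n) : Prop :=
  ~ exists (m : nat) (Y : 'M[B]_(n, m)) (Z : 'M[B]_(m, n)),
      (m < n)%N /\ X = Y *m Z.

Record universal_skew_field (D : nzRingType) (M : unitRingType)
    (iota : {rmorphism D -> M}) : Prop := {
  usf_skew_field : forall x : M, x != 0 -> x \is a GRing.unit;
  usf_contains : injective iota;
  usf_generated : forall S : {pred M}, GRing.divring_closed S ->
    (forall x, iota x \in S) -> forall y, y \in S;
  usf_full : forall n (X : 'M[D]_n), full_mx X ->
    exists Y, inverse_mx (map_mx iota X) Y
}.

Record formal_rep (R : realType) (d : nat) := FormalRep {
  rep_n : nat;
  rep_k : nat;
  rep_A0 : 'M[R[i]]_rep_n;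
  rep_A : 'I_rep_k -> 'M[R[i]]_rep_n;
  rep_b : 'cV[R[i]]_rep_n;
  rep_c : 'cV[R[i]]_rep_n;
  rep_h : 'rV[ncentire R d]_rep_k
}.
Arguments rep_A {R d} _ _.

(* 1 (x) A_0 + sum_j u_j (x) A_j, for u a row over an algebra B. *)
Definition rep_pencil (R : realType) (d : nat) (r : formal_rep R d)
    (B : algType R[i]) (u : 'rV[B]_(rep_k r)) : 'M[B]_(rep_n r) :=
  scalar_entries B (rep_A0 r)
    + \sum_(j < rep_k r) u 0 j *: scalar_entries B (rep_A r j).

Definition rep_bstar (R : realType) (d : nat) (r : formal_rep R d) :
  'rV[R[i]]_(rep_n r) := (map_mx Num.conj (rep_b r))^T.

(* Complex scalars act on the skew field through iota. *)
Definition represents (R : realType) (d : nat) (M : unitRingType)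
    (iota : {rmorphism ncentire R d -> M}) (r : formal_rep R d) (f : M) : Prop :=
  exists Y : 'M[M]_(rep_n r),
    inverse_mx (map_mx iota (rep_pencil (rep_h r))) Y /\
    f = (map_mx iota (scalar_entries (ncentire R d) (rep_bstar r)) *m Y
         *m map_mx iota (scalar_entries (ncentire R d) (rep_c r))) 0 0.

Section RationalEvaluation.
Variables (R : realType) (d : nat) (A : topologicalAlgType R[i]).

Definition rep_pencil_at (r : formal_rep R d) (a : 'rV[A]_d) :
  'M[A]_(rep_n r) := rep_pencil (map_mx (nceval a) (rep_h r)).

Definition rep_value (r : formal_rep R d) (Y : 'M[A]_(rep_n r)) : A :=
  (scalar_entries A (rep_bstar r) *m Y *m scalar_entries A (rep_c r)) 0 0.

Variables (M : unitRingType) (iota : {rmorphism ncentire R d -> M}).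

Definition ncdomain (f : M) : set 'rV[A]_d :=
  [set a | exists r, represents iota r f /\
             exists Y, inverse_mx (rep_pencil_at r a) Y].

Definition ncvalue (f : M) (a : 'rV[A]_d) (y : A) : Prop :=
  exists r Y, [/\ represents iota r f, inverse_mx (rep_pencil_at r a) Y
                & y = rep_value Y].

End RationalEvaluation.

(* Main.v *)
Require Import Defs.
From HB Require Import structures.
From mathcomp Require Import all_boot all_order all_algebra.
From mathcomp Require Import complex lra.
From mathcomp Require Import all_classical all_reals all_analysis.

Set Implicit Arguments.
Unset Strict Implicit.
Unset Printing Implicit Defensive.

Import Order.TTheory GRing.Theory Num.Theory.
Import numFieldNormedType.Exports Normc.

Local Open Scope classical_set_scope.
Local Open Scope ring_scope.

(** Evaluation of entire series.  Let D be the sum of the values p (a x) of a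
    defining seminorm p on the coordinates of the point a.  Submultiplicativity
    bounds the value at a of the degree l part of a series h by K (D e)^l as
    soon as the coefficients satisfy |h_w| <= K e^|w|.  The growth condition on
    an entire series provides such a K for every e > 0, so the homogeneous parts
    decay faster than any geometric sequence [entire_nchom_le]; the partial sums
    are then Cauchy for every p and converge by completeness.  Linearity passes
    to the limit by continuity.  For products, the homogeneous parts multiply
    by the Cauchy product rule [nchomM], and the product of two partial sums
    differs from the partial sum of the product by terms of total degree larger
    than N, which tend to 0 [cauchy_product_le].

    Values of rational functions.  Let f be represented by pencils P1 and P2
    with border vectors (u1, v1) and (u2, v2).  The matrix over the entire
    series with rows (P1, 0, v1), (0, P2, v2), (u1, - u2, 0) has, over the skew
    field, an invertible leading block of size n = n1 + n2 and the Schur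
    complement - (f - f) = 0.  It is therefore singular there
    [bordered_mx_singular] and, by the universal property, not full: it factors
    through a free module of rank at most n.  The evaluation homomorphism
    carries the factorization to the algebra A, where the leading block is
    invertible by hypothesis.  Over a stably finite ring, a factorization of
    inner size at most n and an invertible leading block of size n force the
    Schur complement to vanish [bordered_mx_inner_rank]; up to sign it is
    the difference of the two values. *)

(** * Finite families of neighbourhoods and triangular sums *)

Lemma near_finite_set (J T : Type) (D : set J) (F : set_system T)
    (P : J -> set T) : Filter F -> finite_set D ->
  (forall i, D i -> F (P i)) -> F [set t | forall i, D i -> P i t].
Proof.
elim/Pchoice: J => J in D P *.
move=> FF /finite_fsetP[X ->] FP; exact: filter_bigI.
Qed.

Lemma triangular_sum (V : nmodType) (H : nat -> nat -> V) N :
  \sum_(n < N) \sum_(i < n.+1) H i (n - i)%N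
    = \sum_(i < N) \sum_(k < N | (i + k < N)%N) H i k.
Proof.
transitivity (\sum_(n < N) \sum_(i < N | (i <= n)%N) H i (n - i)%N).
  apply: eq_bigr => n _.
  by rewrite (big_ord_widen _ (fun i => H i (n - i)%N) (ltn_ord n)).
rewrite (exchange_big_dep predT)//=; apply: eq_bigr => i _.
rewrite -(big_mkord (fun n => i <= n)%N (fun n => H i (n - i)%N)).
rewrite -(big_nat_widenl i 0 N xpredT (fun n => H i (n - i)%N))//.
rewrite -{1}[nat_of_ord i]add0n.
rewrite big_addn big_mkord.
rewrite (big_ord_widen _ (fun k => H i (k + i - i)%N) (leq_subr i N)).
by apply: eq_big => [k|k _]; rewrite ?ltn_subRL// addnK.
Qed.

(** * Homogeneous parts of a series evaluated at a point *)

Section HomogeneousParts.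
Variables (R : realType) (d : nat) (A : algType R[i]) (a : 'rV[A]_d).
Implicit Types f g h : ncseries R d.

Definition nctail (x : 'I_d) h : ncseries R d := NCSeries (fun w => h (x :: w)).

(** The value at [a] of the degree [l] part, computed by splitting off the first
    letter of a word: this reduces the product rule and the norm estimate to
    inductions on [l] that involve no tuples. *)
Fixpoint nchom l h : A :=
  if l is k.+1 then \sum_x a 0 x * nchom k (nctail x h) else (h [::])%:A.

Lemma nchomE l h :
  nchom l h = \sum_(w : l.-tuple 'I_d) h w *: \prod_(i <- w) a 0 i.
Proof.
elim: l h => [|l IH] h /=.
  rewrite (bigD1 [tuple])//= big_nil big1 ?addr0// => w.
  by rewrite (tuple0 w) => /eqP.
under eq_bigr do rewrite IH mulr_sumr.
pose cons_pair (p : 'I_d * l.-tuple 'I_d) := [tuple of p.1 :: p.2].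
rewrite pair_big/= [RHS](reindex cons_pair)/=.
  by apply: eq_bigr => -[x w] _ /=; rewrite big_cons scalerAr.
exists (fun w => (thead w, [tuple of behead w])) => [[x w] _|w _] /=.
  by congr (_, _); apply: val_inj.
by rewrite [RHS]tuple_eta.
Qed.

Lemma nchomP l z f g : nchom l (z *: f + g) = z *: nchom l f + nchom l g.
Proof.
elim: l f g => [|l IH] f g /=; first by rewrite scalerDl scalerA.
rewrite scaler_sumr -big_split; apply: eq_bigr => x _ /=.
by rewrite scalerAr -mulrDr -IH.
Qed.

(** Induction on the degree: the tail of f g at a first letter x is
    f_[] g_x + f_x g, where f_x and g_x are the tails of the factors. *)
Lemma nchomM n f g :
  nchom n (f * g) = \sum_(i < n.+1) nchom i f * nchom (n - i) g.
Proof.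
elim: n f g => [|n IH] f g.
  by rewrite big_ord1 /= big_ord1 /= mulr_algl scalerA.
rewrite big_ord_recl subn0 /=.
have tailM x : nctail x (f * g) = f [::] *: nctail x g + nctail x f * g.
  by apply: ncseriesP => w /=; rewrite big_ord_recl.
under eq_bigr do rewrite tailM nchomP IH mulrDr.
rewrite big_split/=; congr (_ + _).
  by rewrite mulr_sumr; apply: eq_bigr => x _; rewrite mulr_algl scalerAr.
under eq_bigr do rewrite mulr_sumr.
rewrite exchange_big; apply: eq_bigr => i _ /=.
by rewrite subSS mulr_suml; apply: eq_bigr => x _; rewrite mulrA.
Qed.

Lemma nchom0 l : nchom l 0 = 0.
Proof. by have := nchomP l (-1) 0 0; rewrite scaler0 addr0 scaleN1r addNr. Qed.

Lemma nchom1S l : nchom l.+1 1 = 0.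
Proof.
rewrite /= big1// => x _.
by rewrite (_ : nctail x 1 = 0) ?nchom0 ?mulr0//; exact: ncseriesP.
Qed.

Lemma nchom_varS l i : nchom l.+1 (ncvar_series R i) = a 0 i * nchom l 1.
Proof.
rewrite /= (bigD1 i)//= big1 ?addr0 => [|x xi].
  by congr (_ * nchom _ _); apply: ncseriesP => w /=; rewrite eqseq_cons eqxx.
rewrite (_ : nctail x _ = 0) ?nchom0 ?mulr0//; apply: ncseriesP => w /=.
by rewrite eqseq_cons (negPf xi).
Qed.

End HomogeneousParts.

(** * Estimates for submultiplicative seminorms *)

Record algebra_seminorm (R : realType) (A : algType R[i]) (p : A -> R) :
    Prop := {
  algsn_ge0 : forall x, 0 <= p x;
  algsnD : forall x y, p (x + y) <= p x + p y;
  algsnZ : forall z x, p (z *: x) = normc z * p x;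
  algsnM : forall x y, p (x * y) <= p x * p y;
  algsn1 : p 1 = 1
}.

Lemma algebra_seminorm_mx (R : realType) (A : algType R[i])
    (rho : forall n, 'M[A]_n -> R) :
  unital_algebra_matrix_seminorm rho ->
  algebra_seminorm (fun x : A => rho 1%N x%:M).
Proof.
move=> hr; split=> [x|x y|z x|x y|].
- exact: (mxseminorm_ge0 hr).
- by rewrite raddfD; exact: (mxseminormD hr).
- rewrite -(mxseminormZ hr)//; congr rho; apply/matrixP => i j.
  by rewrite !ord1 !mxE !mulr1n.
- by rewrite scalar_mxM; exact: (algmxseminormM hr).
- exact: (algmxseminorm1 hr).
Qed.

Section SeminormBounds.
Variables (R : realType) (A : algType R[i]) (p : A -> R).
Hypothesis pP : algebra_seminorm p.

Lemma algsn0 : p 0 = 0.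
Proof. by rewrite -(scale0r 0) (algsnZ pP) normc0 mul0r. Qed.

Lemma algsnN x : p (- x) = p x.
Proof. by rewrite -scaleN1r (algsnZ pP) normcN normc1 mul1r. Qed.

Lemma algsn_sum (J : finType) (P : pred J) (F : J -> A) :
  p (\sum_(j | P j) F j) <= \sum_(j | P j) p (F j).
Proof.
elim/big_ind2 : _ => [|x s y t xs yt|//]; first by rewrite algsn0.
by apply: (le_trans (algsnD pP _ _)); rewrite lerD.
Qed.

Variables (d : nat) (a : 'rV[A]_d).

Lemma nchom_le (h : ncseries R d) (K e : R) l : 0 <= e ->
  (forall w, normc (h w) <= K * e ^+ size w) ->
  p (nchom a l h) <= K * ((\sum_x p (a 0 x)) * e) ^+ l.
Proof.
move=> e0; elim: l h K => [|l IH] h K hK /=.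
  by rewrite (algsnZ pP) (algsn1 pP) mulr1; exact: (hK [::]).
apply: le_trans (algsn_sum _ _) _; rewrite exprS -mulrA mulrCA mulr_suml.
apply: ler_sum => x _; apply: le_trans (algsnM pP _ _) _.
apply: ler_wpM2l; first exact: algsn_ge0.
rewrite mulrA; apply: IH => w.
by rewrite -mulrA -exprS; exact: (hK (x :: w)).
Qed.

(** An entire series has coefficients below K e^|w| for every e > 0; the choice
    e = q / (1 + D), with D the sum of the seminorms of the coordinates of the
    point, absorbs both the number of words and the size of the point. *)
Lemma entire_nchom_le (h : ncentire R d) (q : R) : 0 < q ->
  exists K : R, forall l, p (nchom a l h) <= K * q ^+ l.
Proof.
move=> q0; set D := \sum_x p (a 0 x).
have D0 : 0 <= D by apply: sumr_ge0 => x _; exact: algsn_ge0.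
have D1 : 0 < 1 + D by rewrite ltr_wpDr.
have /asboolP/entire_seriesE/(_ _ (divr_gt0 q0 D1))[K K0 hK] :=
  ncentire_seriesP h.
have e0 : 0 <= q / (1 + D) by rewrite divr_ge0// ltW.
exists K => // l; apply: le_trans (nchom_le l e0 hK) _.
apply: ler_wpM2l => //; apply: lerXn2r; rewrite ?nnegrE ?(ltW q0)//.
  exact: mulr_ge0.
by rewrite mulrCA ler_piMr ?(ltW q0)// ler_pdivrMr// mul1r lerDr.
Qed.

(** The factor K, instead of the 2 K of a crude geometric bound, comes from the
    identity 2^-(l+1) = 2^-l - 2^-(l+1), which makes the tail telescope. *)
Lemma partial_sum_le (u : nat -> A) (K : R) m n : (m <= n)%N ->
  (forall l, p (u l) <= K * 2^-1 ^+ l) ->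
  p (\sum_(l < n.+1) u l - \sum_(l < m.+1) u l) <= K * 2^-1 ^+ m.
Proof.
move=> mn uK; have K0 : 0 <= K.
  by have := uK 0%N; rewrite mulr1; apply: le_trans; exact: algsn_ge0.
suff /le_trans : p (\sum_(l < n.+1) u l - \sum_(l < m.+1) u l)
    <= K * (2^-1 ^+ m - 2^-1 ^+ n).
  by apply; apply: ler_wpM2l => //; rewrite gerBl exprn_ge0.
rewrite -(subnKC mn); elim: (n - m)%N => [|k IH].
  by rewrite addn0 !subrr mulr0 algsn0.
rewrite addnS big_ord_recr/= addrAC.
apply: le_trans (algsnD pP _ _) _.
apply: le_trans (lerD IH (uK _)) _.
rewrite -mulrDr exprS; apply: ler_wpM2l => //; lra.
Qed.

(** The difference consists of fewer than (N + 1)^2 products of total degree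
    larger than N, each at most K L 8^-N, and (N + 1)^2 <= 4^N. *)
Lemma cauchy_product_le (f g : ncseries R d) (K L : R) N :
  (forall l, p (nchom a l f) <= K * 8^-1 ^+ l) ->
  (forall l, p (nchom a l g) <= L * 8^-1 ^+ l) ->
  p ((\sum_(l < N.+1) nchom a l f) * (\sum_(l < N.+1) nchom a l g)
     - \sum_(l < N.+1) nchom a l (f * g)) <= K * L * 2^-1 ^+ N.
Proof.
move=> fK gL.
have K0 : 0 <= K.
  by have := fK 0%N; rewrite mulr1; apply: le_trans; exact: algsn_ge0.
have L0 : 0 <= L.
  by have := gL 0%N; rewrite mulr1; apply: le_trans; exact: algsn_ge0.
under [X in _ - X]eq_bigr do rewrite nchomM.
rewrite (triangular_sum (fun i k => nchom a i f * nchom a k g)).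
rewrite mulr_suml -sumrB.
under eq_bigr => i _.
  rewrite mulr_sumr (bigID (fun k : 'I_N.+1 => (i + k < N.+1)%N))/=.
  rewrite addrAC subrr add0r.
  over.
apply: (@le_trans _ _ (\sum_(i < N.+1) \sum_(k < N.+1) K * L * 8^-1 ^+ N)).
  apply: le_trans (algsn_sum _ _) _; apply: ler_sum => i _.
  apply: le_trans (algsn_sum _ _) _.
  rewrite [leRHS](bigID (fun k : 'I_N.+1 => (i + k < N.+1)%N))/=.
  rewrite -[leLHS]add0r lerD//.
    by apply: sumr_ge0 => k _; rewrite !mulr_ge0// exprn_ge0.
  apply: ler_sum => k; rewrite -leqNgt => Nik.
  apply: le_trans (algsnM pP _ _) _.
  apply: le_trans (ler_pM (algsn_ge0 pP _) (algsn_ge0 pP _) (fK i) (gL k)) _.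
  rewrite mulrACA -exprD; apply: ler_wpM2l; first exact: mulr_ge0.
  by apply: ler_wiXn2l; rewrite ?(ltnW Nik)// invf_le1// ler1n.
rewrite !sumr_const card_ord -mulrnA -[leLHS]mulr_natr -[leLHS]mulrA.
apply: ler_wpM2l; first exact: mulr_ge0.
have -> : 8^-1 = 2^-1 * 4^-1 :> R by lra.
rewrite exprMn -mulrA ler_piMr ?exprn_ge0// exprVn mulrC.
rewrite ler_pdivrMr ?exprn_gt0// mul1r -natrX ler_nat.
have -> : (4 ^ N = 2 ^ N * 2 ^ N)%N by rewrite (expnMn 2 2).
by apply: leq_mul; exact: ltn_expl.
Qed.

End SeminormBounds.

(** * The evaluation homomorphism *)

Section Evaluation.
Variables (R : realType) (d : nat) (A : topologicalAlgType R[i]).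
Variables (I : Type) (rho : I -> forall n, 'M[A]_n -> R).
Hypothesis hA : unital_local_operator_algebra rho.
Hypothesis hcomplete : sequentially_complete A.

Let p i (x : A) : R := @rho i 1%N x%:M.

Let pP i : algebra_seminorm (p i).
Proof. exact: algebra_seminorm_mx (loa_seminorm hA i). Qed.

Lemma cvg_seminorm (T : Type) (F : set_system T) (FF : Filter F)
    (u : T -> A) (l : A) :
  (forall i (e : R), 0 < e -> \forall t \near F, @rho i 1%N (u t - l)%:M < e) ->
  u @ F --> l.
Proof.
move=> ul U /(loa_topology hA)[J finJ [e e0 JU]].
apply: (@filterS _ F FF _ _ _ (near_finite_set FF finJ (fun i _ => ul i e e0))).
move=> t Jt; exact: JU Jt.
Qed.

Lemma geometric_small (K e : R) : 0 < e ->
  \forall N \near \oo, K * 2^-1 ^+ N < e.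
Proof.
move=> e0; have /cvgr_lt : K * 2^-1 ^+ N @[N --> \oo] --> (0 : R).
  rewrite -[0](mulr0 K); apply: cvgMl_tmp; apply: cvg_expr.
  by rewrite ger0_norm// invf_lt1// ltr1n.
exact.
Qed.

Lemma ncpartial_sumE (h : ncentire R d) (a : 'rV[A]_d) N :
  ncpartial_sum h a N = \sum_(l < N.+1) nchom a l h.
Proof. by apply: eq_bigr => l _; rewrite nchomE. Qed.

Variable a : 'rV[A]_d.

Lemma ncpartial_sum_cauchy (h : ncentire R d) :
  (fun q : nat * nat => ncpartial_sum h a q.1 - ncpartial_sum h a q.2)
    @ filter_prod \oo \oo --> (0 : A).
Proof.
apply: cvg_seminorm => i e e0.
have half0 : 0 < 2^-1 :> R by rewrite invr_gt0.
have [K hK] := entire_nchom_le (pP i) a h half0.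
have [N _ hN] := geometric_small K e0.
exists ([set n | (N <= n)%N], [set n | (N <= n)%N]); first by split; exists N.
move=> [n m] /= [Nn Nm]; rewrite subr0 !ncpartial_sumE -/(p i _).
wlog mn : n m Nn Nm / (m <= n)%N => [H|].
  have [/H|/ltnW/H] := leqP m n; first exact.
  by rewrite -opprB (algsnN (pP i)); exact.
by apply: le_lt_trans (partial_sum_le (pP i) mn hK) _; exact: hN.
Qed.

Lemma nceval_cvg (h : ncentire R d) : ncpartial_sum h a @ \oo --> nceval a h.
Proof.
apply: (@xgetPex _ 0 [set x | ncpartial_sum h a @ \oo --> x]).
by apply: hcomplete; exact: ncpartial_sum_cauchy.
Qed.

Lemma nceval_unique (h : ncentire R d) (x : A) :
  ncpartial_sum h a @ \oo --> x -> nceval a h = x.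
Proof.
have U : is_subset1 [set y : A | ncpartial_sum h a @ \oo --> y].
  exact: (cvg_unique (loa_separated hA)).
by move=> hx; apply: (U _ _ (@nceval_cvg h) hx).
Qed.

Lemma cvg_algD (u v : nat -> A) (x y : A) : u @ \oo --> x -> v @ \oo --> y ->
  (fun n => u n + v n) @ \oo --> x + y.
Proof. by move=> ux vy; apply: (cvg_comp2 ux vy (add_continuous (x, y))). Qed.

Lemma cvg_algM (u v : nat -> A) (x y : A) : u @ \oo --> x -> v @ \oo --> y ->
  (fun n => u n * v n) @ \oo --> x * y.
Proof.
by move=> ux vy; apply: (cvg_comp2 ux vy (Defs.mul_continuous (x, y))).
Qed.

Lemma nceval_linear : linear (nceval a : ncentire R d -> A).
Proof.
move=> z f g; apply: nceval_unique.
have -> : ncpartial_sum (z *: f + g) a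
    = (fun n => z%:A * ncpartial_sum f a n + ncpartial_sum g a n).
  apply/funext => n; rewrite !ncpartial_sumE mulr_algl scaler_sumr -big_split.
  by apply: eq_bigr => l _; rewrite /= nchomP.
rewrite -[z *: nceval a f]mulr_algl; apply: cvg_algD; last exact: nceval_cvg.
by apply: cvg_algM; [exact: cvg_cst|exact: nceval_cvg].
Qed.

Lemma nceval1 : nceval a (1 : ncentire R d) = 1.
Proof.
apply: nceval_unique.
have -> : ncpartial_sum (1 : ncentire R d) a = fun=> 1.
  apply/funext => n; rewrite ncpartial_sumE big_ord_recl big1 => [|l _].
    by rewrite /= addr0 scale1r.
  exact: nchom1S.
exact: cvg_cst.
Qed.

Lemma ncevalM (f g : ncentire R d) :
  nceval a (f * g) = nceval a f * nceval a g.
Proof.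
apply: nceval_unique.
pose err n :=
  ncpartial_sum (f * g) a n - ncpartial_sum f a n * ncpartial_sum g a n.
have -> : ncpartial_sum (f * g) a
    = (fun n => err n + ncpartial_sum f a n * ncpartial_sum g a n).
  by apply/funext => n; rewrite subrK.
rewrite -[nceval a f * _]add0r.
apply: cvg_algD; last exact: cvg_algM (@nceval_cvg f) (@nceval_cvg g).
apply: cvg_seminorm => i e e0.
have eighth0 : 0 < 8^-1 :> R by rewrite invr_gt0.
have [K hK] := entire_nchom_le (pP i) a f eighth0.
have [L hL] := entire_nchom_le (pP i) a g eighth0.
near=> N; rewrite subr0 -/(p i _) -(algsnN (pP i)) opprB !ncpartial_sumE.
apply: le_lt_trans (cauchy_product_le (pP i) N hK hL) _.
by near: N; exact: geometric_small.
Unshelve. all: by end_near. Qed.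

Lemma nceval_var i : nceval a (ncvar R i) = a 0 i.
Proof.
apply: nceval_unique; apply: cvg_near_cst.
near=> n; have n0 : (0 < n)%N by near: n; exact: nbhs_infty_gt.
have E0 : nchom a 0 (ncvar R i) = 0 by rewrite /= scale0r.
have E1 : nchom a 1 (ncvar R i) = a 0 i by rewrite nchom_varS /= scale1r mulr1.
rewrite ncpartial_sumE -(prednK n0) big_ord_recl big_ord_recl big1 => [|l _].
  by rewrite -[LHS]/(nchom a 0 (ncvar R i) + (nchom a 1 (ncvar R i) + 0))
    E0 E1 addr0 add0r.
by rewrite -[LHS]/(nchom a l.+2 (ncvar_series R i)) nchom_varS nchom1S mulr0.
Unshelve. all: by end_near. Qed.

Lemma nceval_lrmorphism :
  exists phi : {lrmorphism ncentire R d -> A}, forall h, phi h = nceval a h.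
Proof.
pose phiL := GRing.isLinear.Build _ _ _ _ (nceval a) nceval_linear.
pose phiM := GRing.isMonoidMorphism.Build _ _ (nceval a) (nceval1, ncevalM).
pose phi : {lrmorphism ncentire R d -> A} := HB.pack (nceval a) phiL phiM.
by exists phi.
Qed.

End Evaluation.

(** * Bordered matrices and stable finiteness *)

Definition bordered_mx (B : pzRingType) n (P : 'M[B]_n) (v : 'cV[B]_n)
    (u : 'rV[B]_n) : 'M[B]_(n + 1) := block_mx P v u 0.

(** When the Schur complement - u Q v vanishes, the nonzero row (- u Q, 1)
    annihilates the matrix from the left. *)
Lemma bordered_mx_singular (B : nzRingType) n (P Q : 'M[B]_n) v u :
  inverse_mx P Q -> u *m Q *m v = 0 ->
  ~ exists Y, inverse_mx (bordered_mx P v u) Y.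
Proof.
move=> [PQ QP] uQv [Y [XY _]].
have rowX0 : row_mx (- (u *m Q)) 1%:M *m bordered_mx P v u = 0.
  rewrite /bordered_mx mul_row_block !mul1mx !mulNmx uQv.
  by rewrite -mulmxA QP mulmx1 addNr oppr0 addr0 row_mx0.
have /(congr1 rsubmx) : row_mx (- (u *m Q)) 1%:M = 0 :> 'rV[B]_(n + 1).
  by rewrite -[LHS]mulmx1 -XY mulmxA rowX0 mul0mx.
rewrite row_mxKr => /matrixP/(_ 0 0)/eqP.
by rewrite !mxE eqxx oner_eq0.
Qed.

(** Write Y = (Y1 ; Y2) and Z = (Z1, Z2), so that P = Y1 Z1, v = Y1 Z2,
    u = Y2 Z1 and Y2 Z2 = 0.  From (Q Y1) Z1 = 1, finiteness gives Z1 (Q Y1) = 1,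
    hence u Q v = Y2 (Z1 Q Y1) Z2 = Y2 Z2 = 0. *)
Lemma bordered_mx_inner_rank (B : pzRingType) n (P Q : 'M[B]_n) v u m
    (Y : 'M[B]_(n + 1, m)) (Z : 'M[B]_(m, n + 1)) :
  (forall X X' : 'M[B]_n, X *m X' = 1%:M -> X' *m X = 1%:M) ->
  inverse_mx P Q -> (m < n + 1)%N -> bordered_mx P v u = Y *m Z ->
  u *m Q *m v = 0.
Proof.
move=> fin [PQ QP] mn1; have mn : (m <= n)%N by move: (mn1); rewrite addn1 ltnS.
rewrite -[Y]vsubmxK -[Z]hsubmxK mul_col_row.
move: (usubmx Y) (dsubmx Y) (lsubmx Z) (rsubmx Z) => Y1 Y2 Z1 Z2.
case/eq_block_mx => PE -> -> /esym YZ0.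
suff ZQY : Z1 *m Q *m Y1 = 1%:M.
  have -> : Y2 *m Z1 *m Q *m (Y1 *m Z2) = Y2 *m (Z1 *m Q *m Y1) *m Z2.
    by rewrite !mulmxA.
  by rewrite ZQY mulmx1 YZ0.
move: mn => /subnKC nE; move: (n - m)%N nE => k nE; subst n.
(* Finiteness concerns square matrices: pad [Y1] and [Z1] to size [m + k]. *)
have QYZ : Q *m row_mx Y1 (0 : 'M[B]_(m + k, k)) *m col_mx Z1 0 = 1%:M.
  by rewrite -mulmxA mul_row_col mul0mx addr0 -PE.
have /(congr1 ulsubmx) := fin _ _ QYZ.
rewrite mul_mx_row mul_col_row block_mxKul -mulmxA => ->.
by rewrite (@scalar_mx_block _ m k) block_mxKul.
Qed.

Lemma inverse_mx_diag (B : pzRingType) n1 n2 (P1 Q1 : 'M[B]_n1)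
    (P2 Q2 : 'M[B]_n2) :
  inverse_mx P1 Q1 -> inverse_mx P2 Q2 ->
  inverse_mx (block_mx P1 0 0 P2) (block_mx Q1 0 0 Q2).
Proof.
move=> [PQ1 QP1] [PQ2 QP2].
by split; rewrite mulmx_block !mulmx0 !mul0mx !addr0 !add0r
  ?(PQ1, QP1) ?(PQ2, QP2) -scalar_mx_block.
Qed.

Lemma mulmx_diag_diff (B : pzRingType) n1 n2 (u1 : 'rV[B]_n1) (u2 : 'rV_n2)
    (Q1 : 'M[B]_n1) (Q2 : 'M[B]_n2) (v1 : 'cV_n1) (v2 : 'cV_n2) :
  row_mx u1 (- u2) *m block_mx Q1 0 0 Q2 *m col_mx v1 v2
    = u1 *m Q1 *m v1 - u2 *m Q2 *m v2.
Proof.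
by rewrite mul_row_block !mulmx0 addr0 add0r mul_row_col !mulNmx.
Qed.

Lemma map_bordered_diag (B C : pzRingType) (f : {rmorphism B -> C}) n1 n2
    (P1 : 'M[B]_n1) (P2 : 'M[B]_n2) v1 v2 u1 u2 :
  map_mx f (bordered_mx (block_mx P1 0 0 P2) (col_mx v1 v2) (row_mx u1 (- u2)))
  = bordered_mx (block_mx (map_mx f P1) 0 0 (map_mx f P2))
      (col_mx (map_mx f v1) (map_mx f v2))
      (row_mx (map_mx f u1) (- map_mx f u2)).
Proof.
by rewrite /bordered_mx map_block_mx map_block_mx map_col_mx map_row_mx
  map_mxN !map_mx0.
Qed.

(** * Independence of the representation *)

Section Representations.
Variables (R : realType) (d : nat).
Implicit Types r s : formal_rep R d.

Lemma scalar_entries_map (B C : algType R[i]) (f : {lrmorphism B -> C}) m n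
    (X : 'M[R[i]]_(m, n)) :
  map_mx f (scalar_entries B X) = scalar_entries C X.
Proof. by apply/matrixP => i j; rewrite !mxE rmorph_alg. Qed.

Lemma rep_pencil_map r (B C : algType R[i]) (f : {lrmorphism B -> C})
    (x : 'rV[B]_(rep_k r)) :
  map_mx f (rep_pencil x) = rep_pencil (map_mx f x).
Proof.
rewrite /rep_pencil map_mxD raddf_sum scalar_entries_map; congr (_ + _).
apply: eq_bigr => j _; apply/matrixP => p q; rewrite !mxE.
by apply: etrans (rmorphM f _ _) _; congr (_ * _); exact: rmorph_alg.
Qed.

(** The bordered matrix [X] encodes the difference of the two representations;
    it carries the relation f - f = 0 from the skew field down to the entire
    series, where a homomorphism into the algebra can be applied to it. *)
Lemma rep_value_unique (A : topologicalAlgType R[i]) (a : 'rV[A]_d)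
    (phi : {lrmorphism ncentire R d -> A}) (M : unitRingType)
    (iota : {rmorphism ncentire R d -> M}) r s (f : M) Y Z :
  (forall h, phi h = nceval a h) -> stably_finite A ->
  universal_skew_field iota ->
  represents iota r f -> represents iota s f ->
  inverse_mx (rep_pencil_at r a) Y -> inverse_mx (rep_pencil_at s a) Z ->
  rep_value Y = rep_value Z.
Proof.
move=> phiE fin usf [Yr [rYr fr]] [Ys [sYs fs]] rY sZ.
pose X := bordered_mx
  (block_mx (rep_pencil (rep_h r)) 0 0 (rep_pencil (rep_h s)))
  (col_mx (scalar_entries _ (rep_c r)) (scalar_entries _ (rep_c s)))
  (row_mx (scalar_entries _ (rep_bstar r)) (- scalar_entries _ (rep_bstar s))).
have phi_pencil t : map_mx phi (rep_pencil (rep_h t)) = rep_pencil_at t a.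
  rewrite rep_pencil_map /rep_pencil_at; congr rep_pencil.
  by apply/matrixP => i j; rewrite !mxE phiE.
have /contrapT [m [X1 [X2 [mn XE]]]] : ~ full_mx X.
  move=> /(usf_full usf); rewrite map_bordered_diag.
  apply: bordered_mx_singular; first exact: inverse_mx_diag rYr sYs.
  rewrite mulmx_diag_diff; apply/matrixP => i j.
  by rewrite !ord1 mxE [in X in _ + X]mxE -fr -fs subrr mxE.
have := congr1 (map_mx phi) XE; rewrite map_mxM map_bordered_diag.
rewrite !scalar_entries_map !phi_pencil.
move=> /(bordered_mx_inner_rank (fin _) (inverse_mx_diag rY sZ) mn).
by rewrite mulmx_diag_diff => /eqP; rewrite subr_eq0 /rep_value => /eqP ->.
Qed.
End Representations.

Theorem corollary6p4 (R : realType) (d : nat) (A : topologicalAlgType R[i])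
    (I : Type) (rho : I -> forall n, 'M[A]_n -> R)
    (hA : unital_local_operator_algebra rho)
    (hcomplete : sequentially_complete A) :
  (forall a : 'rV[A]_d,
     (forall h : ncentire R d, ncpartial_sum h a @ \oo --> nceval a h) /\
     exists phi : {lrmorphism ncentire R d -> A},
       (forall h, phi h = nceval a h) /\ (forall i, phi (ncvar R i) = a 0 i)) /\
  (stably_finite A ->
   forall (M : unitRingType) (iota : {rmorphism ncentire R d -> M}),
     universal_skew_field iota ->
     forall (f : M) (a : 'rV[A]_d), ncdomain iota f a ->
       exists! y : A, ncvalue iota f a y).
Proof.
split=> [a|fin M iota usf f a [r [rf [Y rY]]]].
  split=> [h|]; first exact: (nceval_cvg hA hcomplete).
  have [phi phiE] := nceval_lrmorphism hA hcomplete a.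
  by exists phi; split=> // i; rewrite phiE (nceval_var hA hcomplete).
exists (rep_value Y); split; first by exists r, Y.
move=> y [s [Z [sf sZ ->]]].
have [phi phiE] := nceval_lrmorphism hA hcomplete a.
exact: rep_value_unique phiE fin usf rf sf rY sZ.
Qed.
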